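(* Let $X$ be a partial rack with a binary relation $\mathcal R$. For $n\geq 1$ let $C^{PR}_n(X)$ be the free abelian group generated by the $n$-tuples $w=(x_1,\ldots,x_n)$ of elements of $X$ with defect $df(w)=0$, and let $C^{PR}_0(X)=\mathbb Z$. Define $\partial_n\colon C^{PR}_n(X)\to C^{PR}_{n-1}(X)$ by $\partial_1=0$ and, for $n\geq 2$, \[\partial_n(x_1,\ldots,x_n)=\sum_{i=1}^n(-1)^i\big((x_1,\ldots,x_{i-1},x_{i+1},\ldots,x_n)-(x_1*x_i,x_2*x_i,\ldots,x_{i-1}*x_i,x_{i+1},\ldots,x_n)\big).\] Then $(C^{PR}_*(X),\partial_* )$ is a chain complex (in particular, the maps $\partial_n$ are well defined). Let $C^{PD}_n(X)$ be the subgroup of $C^{PR}_n(X)$ generated by the $n$-tuples $(x_1,\ldots,x_n)$ of defect $0$ with $x_i=x_{i+1}$ for some $i\in\{1,\ldots,n-1\}$ if $n\geq 2$, and let $C^{PD}_n(X)=0$ otherwise. If $X$ is a partial quandle with a binary relation, then $(C^{PD}_*(X),\partial_* )$ is a subchain complex of $(C^{PR}_*(X),\partial_* )$, and hence there is a quotient chain complex $(C^{PQ}_*(X),\partial_* )$ with $C^{PQ}_n(X)=C^{PR}_n(X)/C^{PD}_n(X)$.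
   Context: For a relation $\mathcal R$ on $X$, $a\sim_{\mathcal R}b$ means that for all $c\in X$: $a\,\mathcal R\,c$ iff $b\,\mathcal R\,c$, and $c\,\mathcal R\,a$ iff $c\,\mathcal R\,b$. A partial quandle with a binary relation is a set $X$ with two partial operations $*$, $\bar{*}$ and a relation $\mathcal R\subseteq X\times X$ such that: (PQ1) if $x\,\mathcal R\,y$, then $x*y$ and $x\,\bar{*}\,y$ are defined; (PQ2) if $x\,\mathcal R\,y$, then $x*y\sim_{\mathcal R}x$ and $x\,\bar{*}\,y\sim_{\mathcal R}x$; (PQ3) if $x\,\mathcal R\,x$, then $x*x=x=x\,\bar{*}\,x$; (PQ4) if $x\,\mathcal R\,y$, then $(x*y)\,\bar{*}\,y=x=(x\,\bar{*}\,y)*y$; (PQ5) if $x\,\mathcal R\,y$, $x\,\mathcal R\,z$ and $y\,\mathcal R\,z$, then $(x*y)*z=(x*z)*(y*z)$. A partial rack with a binary relation is a structure satisfying (PQ1), (PQ2), (PQ4) and (PQ5). Defect: for an $n$-tuple $w=(x_1,\ldots,x_n)$ of elements of $X$, $df(w)$ is $n(n-1)/2$ minus the number of pairs $i<j$ with $x_i\,\mathcal R\,x_j$. Thus $df(w)=0$ iff $x_i\,\mathcal R\,x_j$ for all $i<j$. *)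

(* Defs.v *)
From HB Require Import structures.
From mathcomp Require Import multinomials.freeg.
From mathcomp Require Import all_boot all_order all_algebra generic_quotient.
From mathcomp Require Import ring_quotient boolp classical_sets.

Set Implicit Arguments.
Unset Strict Implicit.
Unset Printing Implicit Defensive.

Import GRing.Theory.
Local Open Scope ring_scope.
Local Open Scope quotient_scope.
Local Open Scope classical_set_scope.

Definition rel_equiv (X : Type) (R : X -> X -> Prop) (a b : X) : Prop :=
  forall c, (R a c <-> R b c) /\ (R c a <-> R c b).

(* A partial operation is a map [X -> X -> option X], with [None] for
   undefined; [papp] composes such operations strictly. *)
Definition papp (X : Type) (op : X -> X -> option X) (a b : option X) :=
  obind (fun x => obind (op x) b) a.

(* By PQ1 and PQ2, every product in PQ4 and PQ5 is defined, so that the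
   equations below never hold because both sides are [None]. *)
Record partial_rack (X : Type) (R : X -> X -> Prop)
    (op opb : X -> X -> option X) : Prop := PartialRack {
  PQ1 : forall x y, R x y -> op x y <> None /\ opb x y <> None;
  PQ2 : forall x y, R x y ->
    (forall z, op x y = Some z -> rel_equiv R z x) /\
    (forall z, opb x y = Some z -> rel_equiv R z x);
  PQ4 : forall x y, R x y ->
    papp opb (op x y) (Some y) = Some x /\
    papp op (opb x y) (Some y) = Some x;
  PQ5 : forall x y z, R x y -> R x z -> R y z ->
    papp op (op x y) (Some z) = papp op (op x z) (op y z)
}.

Record partial_quandle (X : Type) (R : X -> X -> Prop)
    (op opb : X -> X -> option X) : Prop := PartialQuandle {
  partial_quandle_rack : partial_rack R op opb;
  PQ3 : forall x, R x x -> op x x = Some x /\ opb x x = Some x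
}.

(* The truncated subtraction is harmless: there are n(n-1)/2 pairs i < j. *)
Definition defect (X : Type) (R : X -> X -> Prop) (n : nat)
    (w : n.-tuple X) : nat :=
  ((n * n.-1) %/ 2 -
   #|[set p : 'I_n * 'I_n |
       (p.1 < p.2)%N && `[< R (tnth w p.1) (tnth w p.2) >]]%SET|)%N.

Definition gen (X : Type) (R : X -> X -> Prop) (n : nat) : choiceType :=
  {classic {w : n.-tuple X | defect R w == 0%N}}.

Definition gen_tuple (X : Type) (R : X -> X -> Prop) (n : nat)
    (w : gen R n) : n.-tuple X :=
  sval (w : {w : n.-tuple X | defect R w == 0%N}).

Definition CPR (X : Type) (R : X -> X -> Prop) (n : nat) : zmodType :=
  if n is m.+1 then {freeg (gen R m.+1) / int} else int.

(* [v] is (x_1, ..., x_{i-1}, x_{i+1}, ..., x_n): [lift i] enumerates the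
   positions other than [i] in increasing order. *)
Definition is_deletion (X : Type) (n : nat) (w : n.+1.-tuple X) (i : 'I_n.+1)
    (v : n.-tuple X) : Prop :=
  forall j : 'I_n, tnth v j = tnth w (lift i j).

(* [v] is (x_1 * x_i, ..., x_{i-1} * x_i, x_{i+1}, ..., x_n), all the products
   being defined. *)
Definition is_action (X : Type) (op : X -> X -> option X) (n : nat)
    (w : n.+1.-tuple X) (i : 'I_n.+1) (v : n.-tuple X) : Prop :=
  forall j : 'I_n,
    (if (j < i)%N then op (tnth w (lift i j)) (tnth w i)
     else Some (tnth w (lift i j))) = Some (tnth v j).

(* A differential is indexed by the degree of its target: [d n] is
   \partial_{n+1}. *)
Definition differential (C : nat -> zmodType) : Type :=
  forall n, {additive C n.+1 -> C n}.

(* The families [F] and [G] exist only if all the tuples in the formula are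
   defined and have defect 0; they are then unique.  Since indices start from
   0, the sign is (-1)^(i+1). *)
Definition is_boundary (X : Type) (R : X -> X -> Prop)
    (op : X -> X -> option X) (d : differential (CPR R)) : Prop :=
  (forall x, d 0%N x = 0) /\
  (forall (n : nat) (w : gen R n.+2),
    exists F G : 'I_n.+2 -> gen R n.+1,
      [/\ forall i, is_deletion (gen_tuple w) i (gen_tuple (F i)),
          forall i, is_action op (gen_tuple w) i (gen_tuple (G i))
        & d n.+1 << w >> =
          \sum_(i < n.+2) (<< F i >> - << G i >>) *~ (-1) ^+ i.+1]).

Definition is_complex (C : nat -> zmodType) (d : differential C) : Prop :=
  forall n x, d n (d n.+1 x) = 0.

Definition is_subcomplex (C : nat -> zmodType) (d : differential C)
    (D : forall n, zmodClosed (C n)) : Prop :=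
  forall n x, x \in D n.+1 -> d n x \in D n.

Definition subgroup_gen (V : zmodType) (A : set V) : {pred V} :=
  [in smallest (fun S : set V => zmod_closed [in S]) A].

Fact subgroup_gen_closed (V : zmodType) (A : set V) :
  zmod_closed (subgroup_gen A).
Proof.
split; first by apply/mem_set => S [[S0 _] _]; apply/set_mem: S0.
move=> x y /set_mem Hx /set_mem Hy; apply/mem_set => S HS.
by case: (HS) => [[_ SB] _]; apply/set_mem/SB; apply/mem_set; [exact: Hx | exact: Hy].
Qed.

HB.instance Definition _ (V : zmodType) (A : set V) :=
  GRing.isZmodClosed.Build V (subgroup_gen A) (subgroup_gen_closed A).

Definition degenerate (X : Type) (R : X -> X -> Prop) (n : nat) :
    set (CPR R n) :=
  if n is m.+2 then
    [set << w >> | w in [set w : gen R m.+2 |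
      exists i j : 'I_m.+2, j = i.+1 :> nat /\
        tnth (gen_tuple w) i = tnth (gen_tuple w) j]]
  else set0.

(* For n < 2 this is the subgroup generated by the empty set, that is 0. *)
Definition CPD (X : Type) (R : X -> X -> Prop) (n : nat) :
    zmodClosed (CPR R n) := subgroup_gen (@degenerate X R n).

Definition CPQ (X : Type) (R : X -> X -> Prop) (n : nat) : zmodType :=
  Quotient.quot (CPD R n).

(* Main.v *)
Require Import Defs.
From HB Require Import structures.
From mathcomp Require Import multinomials.freeg boolp classical_sets.
From mathcomp Require Import all_boot all_algebra generic_quotient ring_quotient.
From mathcomp Require Import zify.
Set Implicit Arguments.
Unset Strict Implicit.
Unset Printing Implicit Defensive.
Import GRing.Theory.
Local Open Scope ring_scope.
Local Open Scope quotient_scope.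

(** Every position i of a tuple gives two faces: one deletes x_i, the other
    deletes x_i after letting it act on the entries to its left.  Write
    [face b i] for them, [b = true] being the face with the action.  The
    differential is the alternating sum of the differences
    [face false i - face true i].

    Both faces stay inside the tuples of defect 0: by PQ2 each new entry is
    R-equivalent to the old entry it comes from, and defect 0 means that the
    entries are pairwise related ([defect_eq0P], [face_related]).

    Faces commute as those of a cube ([face_face]):
      face b i (face a (j+1) w) = face a j (face b i w)   for i <= j.
    Only the entries left of x_i need an axiom, and when both faces act it is
    self-distributivity PQ5, (x * z) * (y * z) = (x * y) * z with y = x_i and
    z = x_{j+1}.  Hence in the expansion of the square of the differential the
    terms (j+1, i) and (i, j) agree and carry opposite signs, and everything
    cancels ([alternating_double_sum], [boundary_boundary]).

    Suppose x * x = x whenever x R x, and let w have equal entries at positions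
    i and i+1.  The faces at i and i+1 coincide ([face_succ_repeat]), and they
    have opposite signs, so they cancel; every other face keeps the repetition
    ([face_keeps_repeat]).  So degenerate tuples span a subcomplex, and the
    differential descends to the quotient ([quot_morphism]).

    Uniqueness holds because the faces of a tuple are determined entry by entry
    and an additive map on a free abelian group is determined by its values on
    the generators. *)

(** * Cancellation in alternating double sums *)

(** Passing from n to n+1 adds the row n+1 and the column n; the hypothesis
    identifies their entries T (n+1) i and T i n, whose signs are opposite. *)
Lemma alternating_double_sum_nat (V : zmodType) (n : nat)
    (T : nat -> nat -> V) :
  (forall i j, (i <= j < n)%N -> T j.+1 i = T i j) ->
  \sum_(i < n.+1) \sum_(j < n) T i j *~ ((-1) ^+ i.+1 * (-1) ^+ j.+1) = 0.
Proof.
elim: n => [|n IHn] symT; first by rewrite big_ord_recr big_ord0 /= add0r big_ord0.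
rewrite big_ord_recr /=.
under eq_bigr => i _ do rewrite big_ord_recr /=.
rewrite big_split /= IHn => [|i j /andP[le_ij lt_jn]]; last first.
  by apply: symT; rewrite le_ij ltnW.
rewrite add0r -big_split big1 // => i _ /=.
rewrite symT ?ltnSn ?andbT 1?(leq_ord i) // -mulrzDr.
by rewrite [in X in _ *~ (_ + X)]exprS mulN1r mulNr [X in _ - X]mulrC subrr.
Qed.

(** The same cancellation on ordinals, the form in which the indices of two
    successive faces occur: the first face has one more position to choose
    from than the second. *)
Lemma alternating_double_sum (V : zmodType) (n : nat)
    (T : 'I_n.+2 -> 'I_n.+1 -> V) :
  (forall i j : 'I_n.+1, (i <= j)%N ->
     T (lift ord0 j) i = T (widen_ord (leqnSn _) i) j) ->
  \sum_i \sum_j T i j *~ ((-1) ^+ i.+1 * (-1) ^+ j.+1) = 0.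
Proof.
move=> symT; pose T' i j := T (inord i) (inord j).
rewrite -[RHS](@alternating_double_sum_nat V n.+1 T') => [|i j /andP[le_ij lt_jn]].
  by apply: eq_bigr => i _; apply: eq_bigr => j _; rewrite /T' !inord_val.
have lt_in := leq_ltn_trans le_ij lt_jn.
have -> : T' j.+1 i = T (lift ord0 (inord j)) (inord i).
  by congr (T _ _); apply: val_inj; rewrite /= !inordK.
rewrite symT ?inordK //; congr (T _ _).
by apply: val_inj; rewrite /= !inordK // ltnW.
Qed.

(** * Tuples of defect zero *)

Lemma card_ord_pairs (n : nat) :
  #|[set p : 'I_n * 'I_n | (p.1 < p.2)%N]| = ((n * n.-1) %/ 2)%N.
Proof.
rewrite divn2 -bin2 -triangular_sum big_mkord -sum1_card.
rewrite (eq_bigl (fun p : 'I_n * 'I_n => (p.1 < p.2)%N)); last first.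
  by move=> p; rewrite inE.
rewrite -(pair_big_dep xpredT (fun i j : 'I_n => (i < j)%N) (fun _ _ => 1%N)) /=.
rewrite (exchange_big_dep xpredT) //=; apply: eq_bigr => j _.
by rewrite (big_ord_narrow (ltnW (ltn_ord j))) sum_nat_const card_ord muln1.
Qed.

Definition related (X : Type) (R : X -> X -> Prop) n (w : n.-tuple X) :=
  forall i j : 'I_n, (i < j)%N -> R (tnth w i) (tnth w j).

(** The pairs counted by the defect form a subset of the n(n-1)/2 pairs i < j,
    so the truncated difference vanishes exactly when that subset is full. *)
Lemma defect_eq0P (X : Type) (R : X -> X -> Prop) (n : nat) (w : n.-tuple X) :
  defect R w == 0%N <-> related R w.
Proof.
pose P := [set p : 'I_n * 'I_n | (p.1 < p.2)%N].
pose Q := [set p : 'I_n * 'I_n |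
            (p.1 < p.2)%N && `[< R (tnth w p.1) (tnth w p.2) >]].
have sQP : Q \subset P by apply/subsetP => p; rewrite !inE => /andP[].
have -> : (defect R w == 0%N) = (P \subset Q).
  by rewrite /defect -card_ord_pairs subn_eq0 (geq_leqif (subset_leqif_card sQP)).
split=> [/subsetP sPQ i j lt_ij | related_w].
  by have := sPQ (i, j); rewrite !inE lt_ij /= => /(_ isT) /asboolP.
apply/subsetP => -[i j]; rewrite !inE /= => lt_ij.
by rewrite lt_ij; apply/asboolP/related_w.
Qed.

(** * Free groups, generated subgroups and quotients *)

Lemma freeg_ext (K : choiceType) (V : zmodType)
    (f g : {additive {freeg K / int} -> V}) :
  (forall k, f << k >> = g << k >>) -> f =1 g.
Proof.
move=> eq_fg x; rewrite -[x]freeg_sumE !raddf_sum; apply: eq_bigr => k _ /=.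
by rewrite -[coeff k x]intz -freegU_mulz !raddfMz eq_fg.
Qed.

(** The elements sent into D form a subgroup containing A, hence containing the
    smallest one. *)
Lemma subgroup_gen_sub (V W : zmodType) (A : set V) (D : zmodClosed W)
    (f : {additive V -> W}) :
  (forall x, A x -> f x \in D) -> forall x, x \in subgroup_gen A -> f x \in D.
Proof.
move=> fA x /set_mem /(_ (fun y => f y \in D)); apply; split=> //.
split; first by apply/mem_set; rewrite /= raddf0 rpred0.
move=> y z /set_mem /= Dy /set_mem /= Dz.
by apply/mem_set; rewrite /= raddfB rpredB.
Qed.

Lemma mem_subgroup_gen (V : zmodType) (A : set V) x :
  A x -> x \in subgroup_gen A.
Proof. by move=> Ax; apply/mem_set => S [_]; apply. Qed.

(** The conclusion is a sigma type so that a map can be chosen simultaneously in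
    all degrees of a complex. *)
Lemma quot_morphism (V W : zmodType) (A : zmodClosed V) (B : zmodClosed W)
    (f : {additive V -> W}) :
  (forall x, x \in A -> f x \in B) ->
  {g : {additive Quotient.quot A -> Quotient.quot B} |
    forall x, g (\pi_(Quotient.quot A) x) = \pi_(Quotient.quot B) (f x)}.
Proof.
move=> fAB; pose g (q : Quotient.quot A) := \pi_(Quotient.quot B) (f (repr q)).
have g_pi x : g (\pi_(Quotient.quot A) x) = \pi_(Quotient.quot B) (f x).
  apply/eqP; rewrite -Quotient.idealrBE -raddfB; apply: fAB.
  by rewrite Quotient.idealrBE reprK.
have gB : zmod_morphism g.
  by move=> p q; rewrite -[p]reprK -[q]reprK -raddfB !g_pi !raddfB.
pose gM := GRing.isZmodMorphism.Build _ _ g gB.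
pose ga : {additive Quotient.quot A -> Quotient.quot B} := HB.pack g gM.
by exists ga.
Qed.

(** * The faces of a tuple *)

Section Faces.

Context (X : Type) (R : X -> X -> Prop) (op opb : X -> X -> option X).

(** Totalizes the action, x being the default where x * y is undefined; the
    flag treats the identity and the action uniformly, so that one cubical
    identity covers all four combinations of faces. *)
Definition move_by (b : bool) (x y : X) : X :=
  if b then odflt x (op x y) else x.

Definition face (b : bool) (n : nat) (i : 'I_n.+1) (w : n.+1.-tuple X) :
    n.-tuple X :=
  [tuple (if (k < i)%N then move_by b (tnth w (lift i k)) (tnth w i)
          else tnth w (lift i k)) | k < n].

Lemma tnth_face b n (i : 'I_n.+1) w k :
  tnth (face b i w) k =
    if (k < i)%N then move_by b (tnth w (lift i k)) (tnth w i)
    else tnth w (lift i k).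
Proof. exact: tnth_mktuple. Qed.

Context (hX : partial_rack R op opb).

Lemma op_move_by x y : R x y -> op x y = Some (move_by true x y).
Proof. by move=> /(PQ1 hX)[]; rewrite /move_by; case: (op x y). Qed.

Lemma move_by_equiv b x y : R x y -> rel_equiv R (move_by b x y) x.
Proof.
case: b => [|_ c]; last by [].
by move=> Rxy; apply: (PQ2 hX Rxy).1; apply: op_move_by.
Qed.

(** PQ5 when both flags are set; otherwise both sides are equal by definition.
    PQ2 guarantees that the outer products are defined. *)
Lemma move_by_distr a b x y z : R x y -> R x z -> R y z ->
  move_by b (move_by a x z) (move_by a y z) = move_by a (move_by b x y) z.
Proof.
case: a b => [] [] //= Rxy Rxz Ryz; have := PQ5 hX Rxy Rxz Ryz.
have Rxyz : R (move_by true x y) z by apply/(move_by_equiv true Rxy z).1.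
have Rxzyz : R (move_by true x z) (move_by true y z).
  by apply/(move_by_equiv true Rxz _).1; apply/(move_by_equiv true Ryz _).2.
rewrite (op_move_by Rxy) (op_move_by Rxz) (op_move_by Ryz) /papp /=.
by rewrite (op_move_by Rxyz) (op_move_by Rxzyz) => -[].
Qed.

Lemma face_equiv b n (i : 'I_n.+1) w k : related R w ->
  rel_equiv R (tnth (face b i w) k) (tnth w (lift i k)).
Proof.
move=> Rw; rewrite tnth_face; case: ifP => // lt_ki.
by apply/move_by_equiv/Rw; rewrite /= /bump; lia.
Qed.

Lemma face_related b n (i : 'I_n.+1) w : related R w -> related R (face b i w).
Proof.
move=> Rw k l lt_kl; apply/(face_equiv b i k Rw _).1.
apply/(face_equiv b i l Rw _).2; apply: Rw.
by rewrite /= /bump; lia.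
Qed.

(** The entries right of position i are unaffected by x_i, so both sides have
    the same entry there.  Left of i both faces may act, and the entry is
    (x_k * x_{j+1}) * (x_i * x_{j+1}) on one side and (x_k * x_i) * x_{j+1} on
    the other. *)
Lemma face_face a b n (i j : 'I_n.+1) w : (i <= j)%N -> related R w ->
  face b i (face a (lift ord0 j) w) =
  face a j (face b (widen_ord (leqnSn _) i) w).
Proof.
move=> le_ij Rw; apply: eq_from_tnth => k.
rewrite !tnth_face !lift0 /=.
have -> : lift (lift ord0 j) i = widen_ord (leqnSn _) i.
  by apply: val_inj; rewrite /= /bump; lia.
have -> : lift (widen_ord (leqnSn _) i) j = lift ord0 j.
  by apply: val_inj; rewrite /= /bump; lia.
have -> : lift (widen_ord (leqnSn _) i) (lift j k) =
          lift (lift ord0 j) (lift i k).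
  by apply: val_inj; rewrite /= /bump; lia.
have -> : (i < j.+1)%N by [].
rewrite (ltnNge j i) le_ij /=.
have -> : (bump j k < i)%N = (k < i)%N by rewrite /bump; lia.
have -> : (bump i k < j.+1)%N = (k < j)%N by rewrite /bump; lia.
case: ltnP => [lt_ki|_] //.
rewrite (leq_trans lt_ki le_ij); apply: move_by_distr; apply: Rw.
all: by rewrite /= /bump; lia.
Qed.

(** The two faces could differ only at position i, where one has x_{i+1} and the
    other has x_i or x_i * x_{i+1}; idempotence makes these equal. *)
Lemma face_succ_repeat b n (i j : 'I_n.+1) w :
  (forall x, R x x -> op x x = Some x) -> related R w ->
  j = i.+1 :> nat -> tnth w i = tnth w j -> face b j w = face b i w.
Proof.
move=> idem Rw def_j eq_w; apply: eq_from_tnth => k; rewrite !tnth_face -eq_w.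
have Rii : R (tnth w i) (tnth w i) by rewrite {2}eq_w; apply: Rw; rewrite def_j.
have [def_k|ne_ki] := eqVneq (k : nat) i.
  rewrite def_j def_k ltnSn ltnn.
  have -> : lift j k = i by apply: val_inj; rewrite /= /bump; lia.
  have -> : lift i k = j by apply: val_inj; rewrite /= /bump; lia.
  by rewrite -eq_w /move_by idem //; case: (b).
have -> : lift j k = lift i k by apply: val_inj; rewrite /= /bump; lia.
by rewrite def_j ltnS leq_eqVlt (negPf ne_ki).
Qed.

Definition repeats n (w : n.-tuple X) :=
  exists i j : 'I_n, j = i.+1 :> nat /\ tnth w i = tnth w j.

(** Positions i and i+1 lie on the same side of k, so both entries survive, stay
    adjacent, and are acted upon in the same way. *)
Lemma face_keeps_repeat b n (i j k : 'I_n.+1) w :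
  j = i.+1 :> nat -> tnth w i = tnth w j -> k != i -> k != j ->
  repeats (face b k w).
Proof.
move=> def_j eq_w ne_ki ne_kj.
case: (unlift_some ne_ki) (unlift_some ne_kj) => /= [p def_p _] [q def_q _].
have vp := congr1 val def_p; have vq := congr1 val def_q.
rewrite /= /bump in vp vq; exists p, q; split; first by lia.
rewrite !tnth_face -def_p -def_q eq_w.
by have -> : (q < k)%N = (p < k)%N by lia.
Qed.

(** * The differential *)

Lemma gen_related n (w : gen R n) : related R (gen_tuple w).
Proof. exact/defect_eq0P/(svalP (w : {w : n.-tuple X | defect R w == 0%N})). Qed.

Lemma gen_tuple_inj n : injective (@gen_tuple X R n).
Proof. by move=> v w; apply: val_inj. Qed.

Definition gen_face b n (i : 'I_n.+1) (w : gen R n.+1) : gen R n :=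
  exist _ (face b i (gen_tuple w))
    ((defect_eq0P R _).2 (face_related b i (gen_related w))).

Lemma gen_tuple_face b n (i : 'I_n.+1) (w : gen R n.+1) :
  gen_tuple (gen_face b i w) = face b i (gen_tuple w).
Proof. by []. Qed.

Lemma gen_face_deletion n (w : gen R n.+1) i :
  is_deletion (gen_tuple w) i (gen_tuple (gen_face false i w)).
Proof. by move=> k; rewrite gen_tuple_face tnth_face; case: ifP. Qed.

Lemma gen_face_action n (w : gen R n.+1) i :
  is_action op (gen_tuple w) i (gen_tuple (gen_face true i w)).
Proof.
move=> k; rewrite gen_tuple_face tnth_face; case: ifP => // lt_ki.
by apply/op_move_by/gen_related; rewrite /= /bump; lia.
Qed.

Lemma deletion_unique n (w : n.+1.-tuple X) i u v :
  is_deletion w i u -> is_deletion w i v -> u = v.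
Proof. by move=> Du Dv; apply: eq_from_tnth => k; rewrite Du Dv. Qed.

Lemma action_unique n (w : n.+1.-tuple X) i u v :
  is_action op w i u -> is_action op w i v -> u = v.
Proof.
move=> Au Av; apply: eq_from_tnth => k.
by have := Av k; rewrite Au => -[].
Qed.

Definition gen_boundary n (w : gen R n.+1) : {freeg (gen R n) / int} :=
  \sum_(i < n.+1)
    (<< gen_face false i w >> - << gen_face true i w >>) *~ (-1) ^+ i.+1.

Definition boundary n : CPR R n.+1 -> CPR R n :=
  if n is m.+1 then fglift (@gen_boundary m.+1) else fun=> 0.

Lemma boundary_additive n : zmod_morphism (@boundary n).
Proof.
case: n => [|n] x y /=; first by rewrite subr0.
exact: lift_is_additive.
Qed.

HB.instance Definition _ n :=
  GRing.isZmodMorphism.Build (CPR R n.+1) (CPR R n) (@boundary n)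
    (@boundary_additive n).

Arguments boundary : simpl never.

Lemma boundaryU n (w : gen R n.+2) : boundary (n := n.+1) << w >> = gen_boundary w.
Proof. by rewrite /boundary liftU scale1r. Qed.

(** Grouping the four compositions of faces at positions i, then j, into one
    term T i j turns the commutation of faces into the symmetry that
    cancels the alternating double sum. *)
Lemma boundary_boundary n (x : CPR R n.+2) : boundary (boundary x) = 0.
Proof.
case: n x => // n.
pose dd : {additive CPR R n.+3 -> CPR R n.+1} := @boundary n.+1 \o @boundary n.+2.
apply: (@freeg_ext _ _ dd \0) => w; rewrite /dd /=.
rewrite boundaryU raddf_sum /=.
pose T (i : 'I_n.+3) (j : 'I_n.+2) : {freeg (gen R n.+1) / int} :=
  let t a b := << gen_face b j (gen_face a i w) >> in
  (t false false - t false true) - (t true false - t true true).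
rewrite -[RHS](@alternating_double_sum _ n.+1 T) => [|i j le_ij].
  apply: eq_bigr => i _; rewrite raddfMz raddfB /= !boundaryU /gen_boundary.
  rewrite -sumrB mulrz_suml; apply: eq_bigr => j _.
  by rewrite -mulrzBl -mulrzA (mulrC (_ ^+ j.+1)).
(* Commuting faces exchanges the flags a and b: the two mixed terms are swapped,
   and they have the same sign. *)
have faceC a b : gen_face b i (gen_face a (lift ord0 j) w) =
    gen_face a j (gen_face b (widen_ord (leqnSn _) i) w).
  by apply: gen_tuple_inj; rewrite !gen_tuple_face face_face //; apply: gen_related.
by rewrite /T !faceC !opprB addrACA [- _ - _]addrC addrACA.
Qed.

Lemma boundary_unique (d : differential (CPR R)) :
  is_boundary op d -> forall n x, d n x = boundary x.
Proof.
case=> d0 dS [|n]; first exact: d0.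
apply: (@freeg_ext _ _ (d n.+1) (@boundary n.+1)) => w; rewrite [RHS]boundaryU.
have [F [G [delF actG ->]]] := dS n w.
apply: eq_bigr => i _; congr ((<< _ >> - << _ >>) *~ _); apply: gen_tuple_inj.
  exact: deletion_unique (delF i) (gen_face_deletion w i).
exact: action_unique (actG i) (gen_face_action w i).
Qed.

Lemma boundary_is_boundary : is_boundary op (fun n => @boundary n).
Proof.
split=> // n w; exists (fun i => gen_face false i w), (fun i => gen_face true i w).
split=> [i|i|]; [exact: gen_face_deletion|exact: gen_face_action|].
exact: boundaryU.
Qed.

(** * The degenerate subcomplex *)

Lemma gen_face_degenerate b n (w : gen R n.+2) (i j k : 'I_n.+2) :
  j = i.+1 :> nat -> tnth (gen_tuple w) i = tnth (gen_tuple w) j ->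
  k != i -> k != j -> << gen_face b k w >> \in CPD R n.+1.
Proof.
case: n w i j k => [|n] w i j k def_j eq_w ne_ki ne_kj.
  (* In a pair there is no third position, hence no such face. *)
  move: (ltn_ord j) (ltn_ord k) ne_ki ne_kj; rewrite -!val_eqE /=; lia.
apply: mem_subgroup_gen; exists (gen_face b k w) => //=.
exact: face_keeps_repeat def_j eq_w ne_ki ne_kj.
Qed.

Lemma gen_boundary_repeats n (w : gen R n.+2) :
  (forall x, R x x -> op x x = Some x) ->
  repeats (gen_tuple w) -> gen_boundary w \in CPD R n.+1.
Proof.
move=> idem [i [j [def_j eq_w]]].
have ne_ij : j != i by rewrite -val_eqE /= def_j; lia.
(* The terms at i and i+1 cancel. *)
rewrite /gen_boundary (bigD1 i) //= (bigD1 j) //= addrA.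
have faceC b : gen_face b j w = gen_face b i w.
  by apply: gen_tuple_inj; apply: face_succ_repeat => //; apply: gen_related.
rewrite !faceC def_j [in X in _ + X + _]exprS mulN1r mulrNz subrr add0r.
apply: rpred_sum => k /andP[ne_ki ne_kj].
by apply/rpredMz/rpredB; apply: gen_face_degenerate def_j eq_w ne_ki ne_kj.
Qed.

Lemma boundary_CPD :
  (forall x, R x x -> op x x = Some x) ->
  is_subcomplex (fun n => @boundary n) (CPD R).
Proof.
move=> idem [|n] x Dx; first by rewrite /boundary rpred0.
apply: subgroup_gen_sub Dx => _ [w rep_w <-].
by rewrite /= boundaryU gen_boundary_repeats.
Qed.

End Faces.

Theorem theorem3p16 (X : Type) (R : X -> X -> Prop)
    (op opb : X -> X -> option X) (hX : partial_rack R op opb) :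
  exists d : differential (CPR R),
    [/\ is_boundary op d,
        (forall d' : differential (CPR R), is_boundary op d' ->
           forall n x, d' n x = d n x),
        is_complex d
      & partial_quandle R op opb ->
        is_subcomplex d (CPD R) /\
        exists dQ : differential (CPQ R),
          (forall n (x : CPR R n.+1),
             dQ n (\pi_(Quotient.quot (CPD R n.+1)) x) =
             \pi_(Quotient.quot (CPD R n)) (d n x)) /\
          is_complex dQ].
Proof.
exists (fun n => boundary hX (n := n)).
split=> [|d'|n x|hQ]; first exact: boundary_is_boundary.
- exact: boundary_unique.
- exact: boundary_boundary.
have idem x : R x x -> op x x = Some x by move=> /(PQ3 hQ)[].
have DD := boundary_CPD hX idem; split=> //.
pose dQ n := quot_morphism (f := boundary hX (n := n)) (DD n).
exists (fun n => sval (dQ n)).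
split=> [n x|n q]; first exact: (svalP (dQ n)).
by rewrite -[q]reprK !(svalP (dQ _)) /= boundary_boundary raddf0.
Qed.
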